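(* Let $(M^n,g)$ be an $n$-dimensional Riemannian manifold, $\Omega\subset M^n$ a domain, $q\ge 0$, $p\in\mathbb{R}$, and let $u$ be a positive (classical) solution of $\Delta u+|\nabla u|^qu^p=0$ on $\Omega$. Put $$H:=|\nabla \ln u|^2,\qquad l:=p+q-1,\qquad L:=|\nabla \ln u|^q u^{l}\quad\text{on }\Omega,$$ and $Z:=L/H$ on $\Omega_r(u):=\{x\in\Omega:|\nabla u|(x)>0\}$. Then for any real number $\beta$ and any real-valued function $\sigma$ on $\Omega$, at every point of $\Omega_r(u)$, $$\begin{aligned}\Delta H=\;&A(\beta) H^2+A(\sigma) L^2+B(\beta,\sigma) H L+[2(\beta-1) H+(2 \sigma-q) L]\langle\nabla\ln u, \nabla \ln H\rangle\\ &+2\left|\mathbf{T}(\beta,\sigma)-\frac{\mathrm{tr}(\mathbf{T}(\beta,\sigma))}{n}\, g\right|^2+2\, \mathrm{Ric}(\nabla \ln u, \nabla\ln u),\end{aligned}$$ where $$A(x)=\frac{2}{n}(1+x)^2-2 x^2,\qquad B(x, y)=\frac{4}{n}(1+x)(1+y)-4 x y-2 l,$$ $$\mathbf{T}(\beta,\sigma)=u^{-1} \nabla^2 u-[(1+\beta)+\sigma Z]\, d \ln u \otimes d \ln u .$$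
   Context: $\nabla^2u$ is the Hessian of $u$, $\Delta$ the Laplace–Beltrami operator, $\mathrm{Ric}$ the Ricci tensor; $|\cdot|$ and $\mathrm{tr}$ of a covariant 2-tensor are taken with respect to $g$. When $q=0$, $|\nabla u|^q$ is read as $1$. *)

(* Defs.v *)
From mathcomp Require Import all_boot all_order all_algebra.
From mathcomp Require Import all_classical all_reals all_analysis.

Set Implicit Arguments.
Unset Strict Implicit.
Unset Printing Implicit Defensive.

Import Order.TTheory GRing.Theory Num.Theory.
Import numFieldNormedType.Exports.

Local Open Scope classical_set_scope.
Local Open Scope ring_scope.

(* [Ck k U f] : f is of class C^k on U, where U is meant to be open: the
   iterated partial derivatives of order at most k exist and are continuous
   at every point of U. *)
Fixpoint Ck (R : realType) (n k : nat) (U : set 'rV[R]_n)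
    (f : 'rV[R]_n -> R) : Prop :=
  (forall z, U z -> {for z, continuous f}) /\
  if k is k'.+1 then
    forall i : 'I_n, (forall z, U z -> derivable f z (delta_mx 0 i)) /\
                     Ck k' U ('D_(delta_mx 0 i) f)
  else True.

(* The values of [cmap] off [cdom], and of [cinv] off the image of [cdom],
   are irrelevant. *)
Record chart (R : realType) (n : nat) (M : topologicalType) := Chart {
  cdom : set M;
  cmap : M -> 'rV[R]_n;
  cinv : 'rV[R]_n -> M;
  cdom_open : open cdom;
  cimage_open : open (cmap @` cdom);
  cmapK : forall x, cdom x -> cinv (cmap x) = x;
  cmap_continuous : forall x, cdom x -> {for x, continuous cmap};
  cinv_continuous : forall z, (cmap @` cdom) z -> {for z, continuous cinv} }.

Record manifold (R : realType) (n : nat) := Manifold {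
  carrier :> topologicalType;
  carrier_hausdorff : hausdorff_space carrier;
  carrier_second_countable : @second_countable carrier;
  atlas : set (chart R n carrier);
  atlas_cover : forall x, exists2 c, atlas c & cdom c x;
  atlas_smooth : forall c d, atlas c -> atlas d -> forall (k : nat) (j : 'I_n),
    Ck k (cmap c @` (cdom c `&` cdom d))
         (fun z => cmap d (cinv c z) 0 j) }.

Section Geometry.
Context (R : realType) (n : nat) (M : manifold R n).
Implicit Types (c d : chart R n M) (x : M) (f h : M -> R) (i j k : 'I_n).

Definition Ck_in_chart c (m : nat) (U : set M) f :=
  Ck m (cmap c @` (U `&` cdom c)) (f \o cinv c).

(* A metric is given classically, by its matrix of components g_ij in each
   chart; with the library's convention ['J F] has entries d_i F_j, so the
   tensor law g_ij = d_i y^a d_j y^b g'_ab reads as in [gmetric_transform]. *)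
Record metric := Metric {
  gmat :> chart R n M -> M -> 'M[R]_n;
  gmat_sym : forall c x, atlas c -> cdom c x -> (gmat c x)^T = gmat c x;
  gmat_posdef : forall c x, atlas c -> cdom c x ->
    forall v : 'rV[R]_n, v != 0 -> 0 < (v *m gmat c x *m v^T) 0 0;
  gmat_smooth : forall c, atlas c -> forall (m : nat) i j,
    Ck_in_chart c m setT (fun y => gmat c y i j);
  gmetric_transform : forall c d x, atlas c -> atlas d ->
    cdom c x -> cdom d x ->
    let J := jacobian (cmap d \o cinv c) (cmap c x) in
    gmat c x = J *m gmat d x *m J^T }.

Variable g : metric.

(* In what follows every tensor is given by its components in a chart c, at
   points of [cdom c]; scalars obtained by full contraction do not depend on
   the chart. *)

Definition ginv c x : 'M[R]_n := invmx (g c x).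

Definition pd c i f : M -> R :=
  fun x => 'D_(delta_mx 0 i) (f \o cinv c) (cmap c x).

Definition dform c f x : 'rV[R]_n := \row_i pd c i f x.

Definition grad c f x : 'rV[R]_n := dform c f x *m ginv c x.

(* T(X, Y) for a covariant 2-tensor T and vectors X, Y *)
Definition ev2 (T : 'M[R]_n) (X Y : 'rV[R]_n) : R := (X *m T *m Y^T) 0 0.

Definition gdot c f h x : R := ev2 (g c x) (grad c f x) (grad c h x).

Definition gradnorm c f x : R := Num.sqrt (gdot c f f x).

Definition christoffel c k i j x : R :=
  2^-1 * \sum_l ginv c x k l *
    (pd c i (fun y => g c y j l) x + pd c j (fun y => g c y i l) x
     - pd c l (fun y => g c y i j) x).

Definition hess c f x : 'M[R]_n :=
  \matrix_(i, j) (pd c i (pd c j f) x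
                  - \sum_k christoffel c k i j x * pd c k f x).

Definition trg c x (T : 'M[R]_n) : R := \sum_i \sum_j ginv c x i j * T i j.

Definition normg2 c x (T : 'M[R]_n) : R :=
  \sum_i \sum_j \sum_k \sum_l ginv c x i k * ginv c x j l * T i j * T k l.

Definition laplacian c f x : R := trg c x (hess c f x).

(* Sign convention: Ric is positive on round spheres. *)
Definition ricci c x : 'M[R]_n :=
  \matrix_(i, j) \sum_k
    (pd c k (christoffel c k i j) x - pd c j (christoffel c k i k) x
     + \sum_l (christoffel c k k l x * christoffel c l i j x
               - christoffel c k j l x * christoffel c l i k x)).

Definition is_domain (Om : set M) := [/\ open Om, connected Om & Om !=set0].

(* The part of the regular set {|grad u| > 0} of Om lying in the chart c *)
Definition regular_set c (Om : set M) (u : M -> R) : set M :=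
  [set x | [/\ Om x, cdom c x & 0 < gradnorm c u x]].

(* [a `^ q] is 1 for q = 0 even when a = 0, and 0 for a = 0 < q.
   A C^2 positive solution is smooth where grad u <> 0, by elliptic
   regularity; the C^3 clause records the part of this which is needed for
   the Laplacian of |grad ln u|^2 to make sense on the regular set. *)
Definition positive_classical_solution (Om : set M) (q p : R) (u : M -> R) :=
  (forall x, Om x -> 0 < u x) /\
  forall c, atlas c ->
    [/\ Ck_in_chart c 2 Om u,
        Ck_in_chart c 3 (regular_set c Om u) u &
        forall x, Om x -> cdom c x ->
          laplacian c u x + gradnorm c u x `^ q * u x `^ p = 0].

End Geometry.

(* Main.v *)
Require Import Defs.
From mathcomp Require Import all_boot all_order all_algebra.
From mathcomp Require Import all_classical all_reals all_analysis.
From mathcomp Require Import ring lra.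

Set Implicit Arguments.
Unset Strict Implicit.
Unset Printing Implicit Defensive.

Import Order.TTheory GRing.Theory Num.Theory.
Import numFieldNormedType.Exports.
Local Open Scope classical_set_scope.
Local Open Scope ring_scope.

(** The identity is the Bochner formula for [v = ln u] with its quadratic
    terms regrouped around a free multiple of [dv (x) dv].

    Bochner's formula reads
      Delta |grad v|^2
        = 2 |Hess v|^2 + 2 <grad v, grad Delta v> + 2 Ric(grad v, grad v).
    The equation for [u] becomes [Delta v = - L - H] ([laplacian_ln_u]), and
    [ln L = (q/2) ln H + l v] ([ln_L]), so the middle term is a combination of
    [H], [L] and [<grad v, grad ln H>] ([gdot_laplacian_ln_u]).  Since
    [Hess u / u = Hess v + dv (x) dv], the tensor [T] of the statement is
    [Hess v + b dv (x) dv] with [b H = - (beta H + sigma L)].  Expanding the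
    norm of its traceless part ([traceless_norm]) produces [|Hess v|^2], the
    trace [- L - H + b H], and the cross term [Hess v (grad v, grad v)], which
    is [<grad v, grad H> / 2] ([hess_grad_grad]); what is left is an identity
    between polynomials in [H], [L], [<grad v, grad ln H>].

    Bochner's formula itself ([bochner]) is proved in the single chart at hand
    by matrix calculus.  Covectors are rows, [N_k] is the matrix of
    Christoffel symbols with lower index [k], and a covector field [a] has
    covariant derivative [d_k a - a N_k] ([covd]).  Metric compatibility is
    [d_k G = - (N_k G + G N_k^T)] for the inverse metric [G] ([pd_ginv]); it
    makes the pairing [a G b^T] obey the Leibniz rule for [covd]
    ([pd_pairing]), so that differentiating [H = w G w^T], [w = dv], twice
    gives [|Hess v|^2] and the contraction of the third covariant derivative
    of [v].  Exchanging its first two indices costs a curvature term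
    ([covd3_comm]); the remaining contraction is the gradient of [Delta v]
    ([pd_laplacian]), and the antisymmetry of the curvature with respect to
    the metric turns the curvature term into Ricci ([ricci_contraction]).
    That antisymmetry is read off from [d_j d_i G = d_i d_j G].

    Regularity is the notion [Ck], by partial derivatives.  Everything needed
    from analysis is that it is stable under the operations involved, that
    partial derivatives are derivations, and that they commute
    ([derive_comm], by applying the mean value theorem twice). *)

(** * Symmetry of second derivatives *)

Section Schwarz.
Context (R : realType) (V : normedModType R).
Implicit Types (f : V -> R) (z u v : V).

(** Reduces a directional derivative to a derivative in one real variable,
    where the mean value theorem and the chain rule are available. *)
Lemma is_derive_line f z u (a : R) : derivable f (a *: u + z) u ->
  is_derive a 1 (fun t : R => f (t *: u + z)) ('D_u f (a *: u + z)).
Proof.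
move=> df.
suff e : (fun h : R => h^-1 *: (((fun t : R => f (t *: u + z)) \o shift a) (h *: 1)
             - f (a *: u + z))) =
         (fun h => h^-1 *: ((f \o shift (a *: u + z)) (h *: u) - f (a *: u + z))).
  by split; rewrite ?/derivable ?/derive e.
by apply/funext => h /=; rewrite [h%:A]mulr1 scalerDl addrA.
Qed.

Lemma nbhs_parallelogram z u v (P : set V) : nbhs z P ->
  exists2 s : R, 0 < s & forall a b : R, 0 <= a <= s -> 0 <= b <= s ->
    P (a *: u + (b *: v + z)).
Proof.
move=> /nbhs_normP[e /= e0 eP].
have k0 : 0 < `|u| + `|v| + 1 by rewrite ltr_wpDl// addr_ge0.
exists (e / 2 / (`|u| + `|v| + 1)); first by rewrite !divr_gt0.
move=> a b /andP[a0 ae] /andP[b0 be]; apply: eP => /=.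
rewrite opprD opprD addrCA (addrCA z) subrr addr0.
rewrite (le_lt_trans (ler_normD _ _))// !normrN !normrZ !ger0_norm//.
set s := (e / 2 / _) in ae be.
have : s * (`|u| + `|v| + 1) = e / 2 by rewrite /s mulfVK// gt_eqF.
have s0 : 0 <= s by rewrite (le_trans a0).
have := normr_ge0 u; have := normr_ge0 v.
by nra.
Qed.

(** The increment of [a |-> f (a u + s v + z) - f (a u + z)] over [[0, s]] is
    [s] times a value of its derivative, which is an increment of [D_u f] in
    the direction [v]. *)
Lemma second_difference f (U : set V) z u v (s : R) : 0 < s ->
  (forall x, U x -> derivable f x u) ->
  (forall x, U x -> derivable ('D_u f) x v) ->
  (forall a b, 0 <= a <= s -> 0 <= b <= s -> U (a *: u + (b *: v + z))) ->
  exists a b, [/\ 0 <= a <= s, 0 <= b <= s &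
   f (s *: u + (s *: v + z)) - f (s *: u + z) - (f (s *: v + z) - f z) =
   s ^+ 2 * 'D_v ('D_u f) (a *: u + (b *: v + z))].
Proof.
move=> s0 dfu dfuv sU.
have U0 a : 0 <= a <= s -> U (a *: u + z).
  by move=> a01; have := sU a 0 a01; rewrite scale0r add0r; apply; rewrite lexx ltW.
have Us a : 0 <= a <= s -> U (a *: u + (s *: v + z)).
  by move=> a01; apply: sU => //; rewrite lexx ltW.
pose phi (a : R) := f (a *: u + (s *: v + z)) - f (a *: u + z).
have dphi a : 0 <= a <= s ->
    is_derive a 1 phi ('D_u f (a *: u + (s *: v + z)) - 'D_u f (a *: u + z)).
  by move=> a01; apply: is_deriveB; apply: is_derive_line; apply: dfu; auto.
have [||a] := @MVT_segment _ phi
   (fun a => 'D_u f (a *: u + (s *: v + z)) - 'D_u f (a *: u + z)) 0 s (ltW s0).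
- by move=> x; rewrite in_itv/= => /andP[x0 xs]; apply: dphi; rewrite !ltW.
- apply: derivable_within_continuous => x; rewrite in_itv/= => x01.
  exact: (@ex_derive _ _ _ _ _ _ _ (dphi x x01)).
rewrite in_itv/= => a01 ea.
have [||b] := @MVT_segment _ (fun b => 'D_u f (b *: v + (a *: u + z)))
   (fun b => 'D_v ('D_u f) (b *: v + (a *: u + z))) 0 s (ltW s0).
- move=> x; rewrite in_itv/= => /andP[x0 xs]; apply: is_derive_line.
  by apply: dfuv; rewrite addrCA; apply: sU => //; rewrite !ltW.
- apply: derivable_within_continuous => x; rewrite in_itv/= => x01.
  have /is_derive_line[]// : derivable ('D_u f) (x *: v + (a *: u + z)) v.
  by apply: dfuv; rewrite addrCA; apply: sU.
rewrite in_itv/= => b01 eb; exists a, b; split => //.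
move: ea; rewrite /phi !subr0 !scale0r !add0r => ->.
rewrite subr0 scale0r add0r in eb.
by rewrite addrCA eb addrCA -mulrA mulrC.
Qed.

(** The second difference is symmetric in [u] and [v], so on arbitrarily small
    parallelograms some value of [D_v D_u f] equals some value of [D_u D_v f];
    both are close to their values at [z]. *)
Lemma derive_comm f (U : set V) z u v : nbhs z U ->
  (forall x, U x -> derivable f x u) ->
  (forall x, U x -> derivable f x v) ->
  (forall x, U x -> derivable ('D_u f) x v) ->
  (forall x, U x -> derivable ('D_v f) x u) ->
  {for z, continuous ('D_v ('D_u f))} ->
  {for z, continuous ('D_u ('D_v f))} ->
  'D_v ('D_u f) z = 'D_u ('D_v f) z.
Proof.
move=> zU du dv duv dvu cuv cvu; apply/eqP; rewrite -subr_eq0 -normr_le0.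
apply/ler_addgt0Pr => e e0; rewrite add0r.
have tri (A B w : R) : `|A - w| < e / 2 -> `|B - w| < e / 2 -> `|A - B| <= e.
  move=> h1 h2; rewrite (le_trans (ler_distD w _ _))// ltW//.
  by rewrite [ltRHS]splitr ltrD// distrC.
have e20 : 0 < e / 2 by rewrite divr_gt0.
move/cvgrPdist_lt : cuv => /(_ _ e20) near_uv.
move/cvgrPdist_lt : cvu => /(_ _ e20) near_vu.
have [s s0 sP] := nbhs_parallelogram u v (filterI zU (filterI near_uv near_vu)).
have [a [b [a01 b01 eab]]] := second_difference s0 du duv
   (fun a b a0 b0 => (sP a b a0 b0).1).
have sU' a' b' : 0 <= a' <= s -> 0 <= b' <= s -> U (a' *: v + (b' *: u + z)).
  by move=> ? ?; rewrite addrCA; apply: (sP _ _ _ _).1.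
have [a' [b' [a'01 b'01 eab']]] := second_difference s0 dv dvu sU'.
have [_ [/= huv _]] := sP _ _ a01 b01.
have [_ [_ /= hvu]] := sP _ _ b'01 a'01.
have eD : 'D_v ('D_u f) (a *: u + (b *: v + z)) =
          'D_u ('D_v f) (b' *: u + (a' *: v + z)).
  have s20 : s ^+ 2 != 0 by rewrite expf_neq0// gt_eqF.
  apply: (mulfI s20); apply: etrans (esym eab) _.
  rewrite (addrCA (b' *: u)); apply: etrans _ eab'.
  rewrite (addrCA (s *: v)).
  move: (f _) (f _) (f _) (f z) => p1 p2 p3 p4.
  by rewrite !opprB !addrA; ring.
rewrite eD in huv.
exact: tri huv hvu.
Qed.

End Schwarz.

(** * Functions of class C^k on an open set of coordinates *)

Section Ck_theory.
Context (R : realType) (n : nat) (U : set 'rV[R]_n).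
Hypothesis U_open : open U.
Implicit Types (f h : 'rV[R]_n -> R) (z v : 'rV[R]_n) (k : nat).

Lemma Ck_continuous k f z : Ck k U f -> U z -> {for z, continuous f}.
Proof. by case: k => [|k] [fc _]; apply: fc. Qed.

Lemma Ck_derivable k f z (i : 'I_n) :
  Ck k.+1 U f -> U z -> derivable f z (delta_mx 0 i).
Proof. by move=> [_ /(_ i)[df _]]; apply: df. Qed.

Lemma Ck_derive k f (i : 'I_n) : Ck k.+1 U f -> Ck k U ('D_(delta_mx 0 i) f).
Proof. by move=> [_ /(_ i)[]]. Qed.

Lemma Ck_pred k f : Ck k.+1 U f -> Ck k U f.
Proof.
elim: k f => [|k IH] f [fc df]; split => // i; have [? ?] := df i.
by split => //; apply: IH.
Qed.

Lemma open_near_eq f h z : {in U, f =1 h} -> U z -> \near z, f z = h z.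
Proof.
move=> fh Uz; have : nbhs z U by apply: open_nbhs_nbhs.
by apply: filterS => y Uy; apply: fh; rewrite inE.
Qed.

Lemma open_continuous_ext f h z : {in U, f =1 h} -> U z ->
  {for z, continuous f} -> {for z, continuous h}.
Proof.
move=> fh Uz fc; have fhz : f z = h z by apply: fh; rewrite inE.
suff : h @ z --> f z by rewrite fhz.
exact: (cvg_trans (near_eq_cvg (open_near_eq fh Uz)) fc).
Qed.

Lemma Ck_ext k f h : {in U, f =1 h} -> Ck k U f -> Ck k U h.
Proof.
elim: k f h => [|k IH] f h fh [fc df]; (split=> [z Uz|];
  first exact: open_continuous_ext (fc z Uz)) => // i.
have [dfi Dfi] := df i; split=> [z Uz|].
  by apply: near_eq_derivable (dfi z Uz); apply: open_near_eq.
apply: IH Dfi => z; rewrite inE => Uz.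
by apply: near_eq_derive; apply: open_near_eq.
Qed.

Lemma Ck_cst k (a : R) : Ck k U (fun=> a).
Proof.
elim: k a => [|k IH] a; (split=> [z _|]; first exact: (@cst_continuous _ _ a z)) => // i.
split=> [z _|]; first exact: derivable_cst.
by apply: Ck_ext (IH 0) => z _; rewrite derive_cst.
Qed.

Lemma CkD k f h : Ck k U f -> Ck k U h -> Ck k U (fun z => f z + h z).
Proof.
elim: k f h => [|k IH] f h [fc df] [hc dh]; (split=> [z Uz|];
  first by exact: cvgD (fc z Uz) (hc z Uz)) => // i.
have [dfi Dfi] := df i; have [dhi Dhi] := dh i; split=> [z Uz|].
  by apply: derivableD; auto.
apply: Ck_ext (IH _ _ Dfi Dhi) => z; rewrite inE => Uz.
by rewrite deriveD; auto.
Qed.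

Lemma CkM k f h : Ck k U f -> Ck k U h -> Ck k U (fun z => f z * h z).
Proof.
elim: k f h => [|k IH] f h Cf Ch; (split=> [z Uz|];
  first by exact: cvgM (Ck_continuous Cf Uz) (Ck_continuous Ch Uz)) => // i.
split=> [z Uz|].
  by apply: derivableM; [exact: Ck_derivable Cf Uz|exact: Ck_derivable Ch Uz].
have C1 := IH _ _ (Ck_pred Cf) (Ck_derive i Ch).
have C2 := IH _ _ (Ck_pred Ch) (Ck_derive i Cf).
apply: Ck_ext (CkD C1 C2) => z; rewrite inE => Uz.
by rewrite deriveM//; [exact: Ck_derivable Cf Uz|exact: Ck_derivable Ch Uz].
Qed.

Lemma CkV k f : (forall z, U z -> f z != 0) ->
  Ck k U f -> Ck k U (fun z => (f z)^-1).
Proof.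
move=> f0; elim: k => [|k IH] Cf; (split=> [z Uz|];
  first exact: cvgV (f0 z Uz) (Ck_continuous Cf Uz)) => // i.
split=> [z Uz|].
  by apply: derivableV; [exact: f0|exact: Ck_derivable Cf Uz].
have CV := IH (Ck_pred Cf).
apply: Ck_ext (CkM (CkM (Ck_cst k (-1)) (CkM CV CV)) (Ck_derive i Cf)) => z.
rewrite inE => Uz; rewrite deriveV ?f0//; last exact: Ck_derivable Cf Uz.
by rewrite mulN1r exprnN/= -invfM.
Qed.

(** Directional differentiability is weaker than differentiability, so the
    chain rule is applied along the line through [z]. *)
Lemma is_derive_comp_ln f z v : 0 < f z -> derivable f z v ->
  is_derive z v (fun y => ln (f y)) ((f z)^-1 * 'D_v f z).
Proof.
move=> f0 df.
have df0 : is_derive (0 : R) 1 (fun t : R => f (t *: v + z)) ('D_v f z).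
  have := @is_derive_line R _ f z v 0; rewrite scale0r add0r; exact.
have dln : is_derive (0 : R) 1 (fun t : R => ln (f (t *: v + z)))
    ((f z)^-1 * 'D_v f z).
  apply: (@is_derive1_comp _ (@ln R) (fun t : R => f (t *: v + z))).
  by rewrite scale0r add0r; exact: is_derive1_ln.
have e : (fun h : R => h^-1 *: (((fun t : R => ln (f (t *: v + z))) \o shift 0)
      (h *: 1) - ln (f (0 *: v + z)))) =
    (fun h : R => h^-1 *: (((fun y => ln (f y)) \o shift z) (h *: v) - ln (f z))).
  by apply/funext => h /=; rewrite [h%:A]mulr1 addr0 scale0r add0r.
by case: dln; rewrite /derivable /derive e => d1 d2; split.
Qed.

Lemma Ck_ln k f : (forall z, U z -> 0 < f z) ->
  Ck k U f -> Ck k U (fun z => ln (f z)).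
Proof.
move=> f0; elim: k => [|k IH] Cf; (split=> [z Uz|];
  first by apply: (cvg_comp f (@ln R));
    [exact: Ck_continuous Cf Uz|exact/continuous_ln/f0]) => // i.
have d z (Uz : U z) := is_derive_comp_ln (f0 z Uz) (Ck_derivable (i := i) Cf Uz).
split=> [z Uz|]; first by have [] := d z Uz.
have CV : Ck k U (fun z => (f z)^-1).
  by apply: CkV (Ck_pred Cf) => z Uz; rewrite gt_eqF ?f0.
apply: Ck_ext (CkM CV (Ck_derive i Cf)) => z; rewrite inE => Uz.
by have [_ ->] := d z Uz.
Qed.

Lemma Ck_derive_comm k f z (i j : 'I_n) : Ck k.+2 U f -> U z ->
  'D_(delta_mx 0 i) ('D_(delta_mx 0 j) f) z =
  'D_(delta_mx 0 j) ('D_(delta_mx 0 i) f) z.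
Proof.
move=> Cf Uz.
have D1 l y (Uy : U y) := Ck_derivable (i := l) Cf Uy.
have D2 l m y (Uy : U y) := Ck_derivable (i := m) (Ck_derive l Cf) Uy.
have D3 l m := Ck_continuous (Ck_derive m (Ck_derive l Cf)) Uz.
have zU : nbhs z U by apply: open_nbhs_nbhs.
by apply: (derive_comm zU); auto.
Qed.

End Ck_theory.

Lemma Ck_subset (R : realType) (n k : nat) (U V : set 'rV[R]_n) f :
  U `<=` V -> Ck k V f -> Ck k U f.
Proof.
move=> UV; elim: k f => [|k IH] f [fc df]; (split=> [z /UV|]; first exact: fc) => // i.
by have [dfi Dfi] := df i; split=> [z /UV|]; [exact: dfi|exact: IH].
Qed.

(** * Differential calculus in a chart *)

(** For [W] inside the chart domain this is [Ck_in_chart c k W f]; the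
    intersection of [W] with the domain is left out because all sets below
    are such. *)
Definition chartCk (R : realType) (n : nat) (M : topologicalType)
    (c : chart R n M) (W : set M) (k : nat) (f : M -> R) :=
  Ck k (cmap c @` W) (f \o cinv c).

Definition chartCk_mx (R : realType) (n : nat) (M : topologicalType)
    (c : chart R n M) (W : set M) (k a b : nat) (F : M -> 'M[R]_(a, b)) :=
  forall i j, chartCk c W k (fun y => F y i j).

Definition pd_mx (R : realType) (n : nat) (M : manifold R n) (c : chart R n M)
    (a b : nat) (i : 'I_n) (F : M -> 'M[R]_(a, b)) (x : M) : 'M[R]_(a, b) :=
  \matrix_(r, s) pd c i (fun y => F y r s) x.

Section ChartCalculus.
Context (R : realType) (n : nat) (M : manifold R n) (c : chart R n M).
Context (W : set M).
Hypothesis W_cdom : W `<=` cdom c.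
Hypothesis W_image_open : open (cmap c @` W).
Implicit Types (f h : M -> R) (y : M) (i j : 'I_n) (k : nat).

Lemma cinvK z : (cmap c @` W) z -> W (cinv c z) /\ cmap c (cinv c z) = z.
Proof. by move=> [y Wy <-]; rewrite cmapK//; exact: W_cdom. Qed.

Lemma cmap_image y : W y -> (cmap c @` W) (cmap c y).
Proof. by move=> Wy; exists y. Qed.

Lemma chartCk_ext k f h : (forall y, W y -> f y = h y) ->
  chartCk c W k f -> chartCk c W k h.
Proof.
move=> fh; apply: Ck_ext => // z; rewrite inE => /cinvK[Wz _] /=.
exact: fh.
Qed.

Lemma chartCk_pred k f : chartCk c W k.+1 f -> chartCk c W k f.
Proof. exact: Ck_pred. Qed.

Lemma chartCk_le k m f : (k <= m)%N -> chartCk c W m f -> chartCk c W k f.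
Proof.
move=> /subnK <-; elim: (m - k)%N => [|d IH]//.
by rewrite addSn => /chartCk_pred.
Qed.

Lemma chartCk_pd k f i : chartCk c W k.+1 f -> chartCk c W k (pd c i f).
Proof.
move=> Cf; apply: (Ck_ext W_image_open _ (Ck_derive i Cf)) => z.
by rewrite inE => /cinvK[_ /= cz]; rewrite /pd cz.
Qed.

Lemma chartCk_cst k (a : R) : chartCk c W k (fun=> a).
Proof. exact: Ck_cst. Qed.

Lemma chartCkD k f h : chartCk c W k f -> chartCk c W k h ->
  chartCk c W k (fun y => f y + h y).
Proof. exact: CkD. Qed.

Lemma chartCkM k f h : chartCk c W k f -> chartCk c W k h ->
  chartCk c W k (fun y => f y * h y).
Proof. exact: CkM. Qed.

Lemma chartCkZ k (a : R) f : chartCk c W k f ->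
  chartCk c W k (fun y => a * f y).
Proof. by apply: chartCkM; exact: chartCk_cst. Qed.

Lemma chartCkN k f : chartCk c W k f -> chartCk c W k (fun y => - f y).
Proof.
by move=> /(chartCkZ (-1)); apply: chartCk_ext => y _; rewrite mulN1r.
Qed.

Lemma chartCkB k f h : chartCk c W k f -> chartCk c W k h ->
  chartCk c W k (fun y => f y - h y).
Proof. by move=> Cf Ch; apply: chartCkD => //; exact: chartCkN. Qed.

Lemma chartCkV k f : (forall y, W y -> f y != 0) ->
  chartCk c W k f -> chartCk c W k (fun y => (f y)^-1).
Proof.
move=> f0 Cf; apply: (CkV W_image_open) Cf => z /cinvK[Wz _].
exact: f0.
Qed.

Lemma chartCk_ln k f : (forall y, W y -> 0 < f y) ->
  chartCk c W k f -> chartCk c W k (fun y => ln (f y)).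
Proof.
move=> f0 Cf; apply: (Ck_ln W_image_open) Cf => z /cinvK[Wz _].
exact: f0.
Qed.

Lemma chartCk_sum k (I : Type) (r : seq I) (P : pred I) (F : I -> M -> R) :
  (forall m, P m -> chartCk c W k (F m)) ->
  chartCk c W k (fun y => \sum_(m <- r | P m) F m y).
Proof.
move=> CF; elim: r => [|a r IH].
  by apply: chartCk_ext (chartCk_cst k 0) => y _; rewrite big_nil.
have [Pa|Pa] := boolP (P a); last first.
  by apply: chartCk_ext IH => y _; rewrite big_cons (negbTE Pa).
by apply: chartCk_ext (chartCkD (CF a Pa) IH) => y _; rewrite big_cons Pa.
Qed.

Lemma chartCk_prod k (I : Type) (r : seq I) (F : I -> M -> R) :
  (forall m, chartCk c W k (F m)) ->
  chartCk c W k (fun y => \prod_(m <- r) F m y).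
Proof.
move=> CF; elim: r => [|a r IH].
  by apply: chartCk_ext (chartCk_cst k 1) => y _; rewrite big_nil.
by apply: chartCk_ext (chartCkM (CF a) IH) => y _; rewrite big_cons.
Qed.

Lemma pd_ext i f h y : (forall y, W y -> f y = h y) -> W y ->
  pd c i f y = pd c i h y.
Proof.
move=> fh Wy; apply: near_eq_derive; apply: (open_near_eq W_image_open).
  by move=> z; rewrite inE => /cinvK[Wz _] /=; exact: fh.
exact: cmap_image.
Qed.

Lemma chart_derivable i f y : chartCk c W 1 f -> W y ->
  derivable (f \o cinv c) (cmap c y) (delta_mx 0 i).
Proof.
move=> Cf Wy; have cWy := cmap_image Wy.
exact: (@Ck_derivable R n _ 0 _ _ i Cf cWy).
Qed.

Lemma pd_cst i (a : R) y : pd c i (fun=> a) y = 0.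
Proof. by rewrite /pd derive_cst. Qed.

Lemma pdD i f h y : chartCk c W 1 f -> chartCk c W 1 h -> W y ->
  pd c i (fun y => f y + h y) y = pd c i f y + pd c i h y.
Proof. by move=> Cf Ch Wy; rewrite -deriveD//; exact: chart_derivable. Qed.

Lemma pdM i f h y : chartCk c W 1 f -> chartCk c W 1 h -> W y ->
  pd c i (fun y => f y * h y) y = pd c i f y * h y + f y * pd c i h y.
Proof.
move=> Cf Ch Wy.
have := deriveM (chart_derivable (i := i) Cf Wy) (chart_derivable (i := i) Ch Wy).
rewrite /pd => ->; rewrite /= cmapK; last exact: W_cdom.
by rewrite addrC [_ *: _]mulrC.
Qed.

Lemma pdZ i (a : R) f y : chartCk c W 1 f -> W y ->
  pd c i (fun y => a * f y) y = a * pd c i f y.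
Proof.
move=> Cf Wy; rewrite (pdM i (chartCk_cst 1 a) Cf Wy).
by rewrite pd_cst mul0r add0r.
Qed.

Lemma pdN i f y : chartCk c W 1 f -> W y ->
  pd c i (fun y => - f y) y = - pd c i f y.
Proof.
move=> Cf Wy; rewrite -mulN1r -pdZ//.
by apply: pd_ext => // z _; rewrite mulN1r.
Qed.

Lemma pd_ln i f y : (forall y, W y -> 0 < f y) -> chartCk c W 1 f -> W y ->
  pd c i (fun y => ln (f y)) y = (f y)^-1 * pd c i f y.
Proof.
move=> f0 Cf Wy.
have fy : 0 < (f \o cinv c) (cmap c y).
  by rewrite /= cmapK; [exact: f0|exact: W_cdom].
have [_] := is_derive_comp_ln fy (chart_derivable (i := i) Cf Wy).
rewrite /= cmapK; last exact: W_cdom.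
by move=> <-.
Qed.

Lemma pd_sum i (I : Type) (r : seq I) (F : I -> M -> R) y :
  (forall m, chartCk c W 1 (F m)) -> W y ->
  pd c i (fun y => \sum_(m <- r) F m y) y = \sum_(m <- r) pd c i (F m) y.
Proof.
move=> CF Wy; elim: r => [|a r IH].
  rewrite big_nil (pd_ext i (h := fun=> 0) _ Wy) ?pd_cst// => z _.
  by rewrite big_nil.
rewrite big_cons -IH -pdD//; last by apply: chartCk_sum.
by apply: pd_ext => // z _; rewrite big_cons.
Qed.

Lemma pd_comm i j f y : chartCk c W 2 f -> W y ->
  pd c i (pd c j f) y = pd c j (pd c i f) y.
Proof.
move=> Cf Wy; have cWy := cmap_image Wy.
have e l : {in cmap c @` W, pd c l f \o cinv c =1 'D_(delta_mx 0 l) (f \o cinv c)}.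
  by move=> z; rewrite inE => /cinvK[_ /= cz]; rewrite /pd cz.
rewrite /pd (near_eq_derive _ (open_near_eq W_image_open (e j) cWy)).
rewrite [RHS](near_eq_derive _ (open_near_eq W_image_open (e i) cWy)).
exact: (Ck_derive_comm W_image_open (k := 0) i j Cf cWy).
Qed.

Section Matrices.
Context (a b d : nat).
Implicit Types (F : M -> 'M[R]_(a, b)) (K : M -> 'M[R]_(b, d)).

Lemma chartCk_mx_le k m F : (k <= m)%N ->
  chartCk_mx c W m F -> chartCk_mx c W k F.
Proof. by move=> km CF r s; apply: chartCk_le (CF r s). Qed.

Lemma chartCk_mxD k F F' : chartCk_mx c W k F -> chartCk_mx c W k F' ->
  chartCk_mx c W k (fun y => F y + F' y).
Proof.
move=> CF CF' r s; apply: chartCk_ext (chartCkD (CF r s) (CF' r s)) => y _.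
by rewrite mxE.
Qed.

Lemma chartCk_mxN k F : chartCk_mx c W k F -> chartCk_mx c W k (fun y => - F y).
Proof.
by move=> CF r s; apply: chartCk_ext (chartCkN (CF r s)) => y _; rewrite mxE.
Qed.

Lemma chartCk_mxM k F K : chartCk_mx c W k F -> chartCk_mx c W k K ->
  chartCk_mx c W k (fun y => F y *m K y).
Proof.
move=> CF CK r s.
apply: chartCk_ext
  (chartCk_sum _ (fun l _ => chartCkM (CF r l) (CK l s))) => y _.
by rewrite mxE.
Qed.

Lemma chartCk_mx_tr k F : chartCk_mx c W k F ->
  chartCk_mx c W k (fun y => (F y)^T).
Proof. by move=> CF r s; apply: chartCk_ext (CF s r) => y _; rewrite mxE. Qed.

Lemma chartCk_mx_pd k i F : chartCk_mx c W k.+1 F ->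
  chartCk_mx c W k (pd_mx c i F).
Proof.
by move=> CF r s; apply: chartCk_ext (chartCk_pd i (CF r s)) => y _; rewrite mxE.
Qed.

Lemma pd_mx_ext i F F' y : (forall y, W y -> F y = F' y) -> W y ->
  pd_mx c i F y = pd_mx c i F' y.
Proof.
move=> FF Wy; apply/matrixP => r s; rewrite !mxE; apply: pd_ext => // z Wz.
by rewrite FF.
Qed.

Lemma pd_mx_cst i (A : 'M[R]_(a, b)) y : pd_mx c i (fun=> A) y = 0.
Proof. by apply/matrixP => r s; rewrite !mxE pd_cst. Qed.

Lemma pd_mxD i F F' y : chartCk_mx c W 1 F -> chartCk_mx c W 1 F' -> W y ->
  pd_mx c i (fun y => F y + F' y) y = pd_mx c i F y + pd_mx c i F' y.
Proof.
move=> CF CF' Wy; apply/matrixP => r s; rewrite !mxE -pdD//.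
by apply: pd_ext => // z _; rewrite mxE.
Qed.

Lemma pd_mxN i F y : chartCk_mx c W 1 F -> W y ->
  pd_mx c i (fun y => - F y) y = - pd_mx c i F y.
Proof.
move=> CF Wy; apply/matrixP => r s; rewrite !mxE -pdN//.
by apply: pd_ext => // z _; rewrite mxE.
Qed.

Lemma pd_mx_tr i F y : pd_mx c i (fun y => (F y)^T) y = (pd_mx c i F y)^T.
Proof.
apply/matrixP => r s; rewrite !mxE; congr (pd c i _ y).
by apply/funext => z; rewrite mxE.
Qed.

Lemma pd_mxM i F K y : chartCk_mx c W 1 F -> chartCk_mx c W 1 K -> W y ->
  pd_mx c i (fun y => F y *m K y) y = pd_mx c i F y *m K y + F y *m pd_mx c i K y.
Proof.
move=> CF CK Wy; apply/matrixP => r s; rewrite !mxE -big_split/=.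
rewrite (pd_ext i (h := fun y => \sum_j F y r j * K y j s) _ Wy); last first.
  by move=> z _; rewrite mxE.
rewrite pd_sum//; last by move=> l; exact: chartCkM.
by apply: eq_bigr => l _; rewrite pdM// !mxE.
Qed.

Lemma pd_mx_comm i j F y : chartCk_mx c W 2 F -> W y ->
  pd_mx c i (pd_mx c j F) y = pd_mx c j (pd_mx c i F) y.
Proof.
move=> CF Wy; apply/matrixP => r s; rewrite [LHS]mxE [RHS]mxE.
have e l m : pd c l (fun y => pd_mx c m F y r s) y =
             pd c l (pd c m (fun y => F y r s)) y.
  by apply: pd_ext Wy => z _; rewrite mxE.
apply: etrans (e i j) _; apply: etrans _ (esym (e j i)).
exact: pd_comm (CF r s) Wy.
Qed.

End Matrices.

Lemma pd_mxtrace i (a : nat) (F : M -> 'M[R]_a) y : chartCk_mx c W 1 F -> W y ->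
  pd c i (fun y => \tr (F y)) y = \tr (pd_mx c i F y).
Proof.
by move=> CF Wy; rewrite pd_sum//; apply: eq_bigr => l _; rewrite mxE.
Qed.

Lemma chartCk_det k (a : nat) (F : M -> 'M[R]_a) :
  chartCk_mx c W k F -> chartCk c W k (fun y => \det (F y)).
Proof.
move=> CF; apply: chartCk_sum => s _.
by apply: chartCkZ; apply: chartCk_prod => i; exact: CF.
Qed.

(** By Cramer's rule the entries of the inverse are rational functions of the
    entries of the matrix. *)
Lemma chartCk_mx_inv k (a : nat) (F : M -> 'M[R]_a) :
  (forall y, W y -> F y \in unitmx) ->
  chartCk_mx c W k F -> chartCk_mx c W k (fun y => invmx (F y)).
Proof.
move=> uF CF r s.
have Cdet : chartCk c W k (fun y => (\det (F y))^-1).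
  apply: chartCkV; last exact: chartCk_det.
  by move=> y /uF; rewrite unitmxE unitfE.
have Ccof : chartCk c W k (fun y => cofactor (F y) s r).
  apply: chartCkZ; apply: (chartCk_det (F := fun y => row' s (col' r (F y)))).
  move=> l m; apply: chartCk_ext (CF (lift s l) (lift r m)) => y _.
  by rewrite !mxE.
apply: chartCk_ext (chartCkM Cdet Ccof) => y Wy.
by rewrite /invmx uF// !mxE.
Qed.

End ChartCalculus.

(** * Connection, curvature and Bochner's formula *)

(** The matrix through which the k-th covariant derivative acts on a row of
    covector components, from the right. *)
Definition connection (R : realType) (n : nat) (M : manifold R n)
    (g : metric M) (c : chart R n M) (k : 'I_n) (x : M) : 'M[R]_n :=
  \matrix_(m, l) christoffel g c m k l x.

(** [a |-> - a *m curvature j i] is the commutator of the j-th and i-th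
    covariant derivatives on covectors; the entry (m, k) is the component
    R^m_kji of the Riemann tensor. *)
Definition curvature (R : realType) (n : nat) (M : manifold R n)
    (g : metric M) (c : chart R n M) (j i : 'I_n) (x : M) : 'M[R]_n :=
  let N k := connection g c k in
  pd_mx c j (N i) x - pd_mx c i (N j) x + (N j x *m N i x - N i x *m N j x).

(** The hypothesis is [d_j d_i K = d_i d_j K] for a matrix function with
    [d_k K = - (N_k K + K N_k^T)], where [A] and [B] stand for [d_j N_i] and
    [d_i N_j], and [P] and [Q] for [N_i] and [N_j].  The terms mixing both
    sides, such as [P K Q^T], are symmetric in the two indices and cancel. *)
Lemma commutator_antisym (R : comRingType) (n : nat) (A B P Q K : 'M[R]_n) :
  K^T = K ->
  - (A *m K - P *m (Q *m K + K *m Q^T)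
     + (- (Q *m K + K *m Q^T) *m P^T + K *m A^T)) =
  - (B *m K - Q *m (P *m K + K *m P^T)
     + (- (P *m K + K *m P^T) *m Q^T + K *m B^T)) ->
  ((A - B + (Q *m P - P *m Q)) *m K)^T = - ((A - B + (Q *m P - P *m Q)) *m K).
Proof.
move=> Ks /eqP; rewrite -subr_eq0 => /eqP h.
have trD (X Y : 'M[R]_n) : (X + Y)^T = X^T + Y^T.
  by apply/matrixP => r s; rewrite !mxE.
have trN (X : 'M[R]_n) : (- X)^T = - X^T.
  by apply/matrixP => r s; rewrite !mxE.
apply/eqP; rewrite -subr_eq0 opprK; rewrite trmx_mul Ks !(trD, trN) !trmx_mul.
apply/eqP; rewrite -[RHS]oppr0 -h.
rewrite !(mulmxDr, mulmxDl, mulmxN, mulNmx) !mulmxA !opprD !opprK.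
by apply/matrixP => r s; rewrite !mxE; ring.
Qed.

Lemma trmx11 (R : pzRingType) (A : 'M[R]_1) : A^T = A.
Proof. by rewrite [A]mx11_scalar tr_scalar_mx. Qed.

Lemma trg_mxtrace (R : realType) (n : nat) (M : manifold R n) (g : metric M)
    (c : chart R n M) (x : M) (T : 'M[R]_n) :
  trg g c x T = \tr (ginv g c x *m T^T).
Proof.
by apply: eq_bigr => i _; rewrite mxE; apply: eq_bigr => j _; rewrite mxE.
Qed.

Section Bochner.
Context (R : realType) (n : nat) (M : manifold R n) (g : metric M).
Context (c : chart R n M) (W : set M).
Hypothesis c_atlas : atlas c.
Hypothesis W_cdom : W `<=` cdom c.
Hypothesis W_image_open : open (cmap c @` W).
Implicit Types (i j k l m : 'I_n) (y : M).

Let G := ginv g c.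
Let N := connection g c.

Lemma gmat_unit y : W y -> g c y \in unitmx.
Proof.
move=> Wy; apply: contraT => nu; have cy := W_cdom Wy.
have /rowV0Pn[v vk v0] : kermx (g c y) != 0.
  by rewrite kermx_eq0 row_free_unit.
have := gmat_posdef g c_atlas cy v0.
by rewrite (sub_kermxP vk) mul0mx mxE ltxx.
Qed.

Lemma gmat_chartCk (k : nat) : chartCk_mx c W k (g c).
Proof.
move=> i j; apply: (Ck_subset _ (gmat_smooth g c_atlas k i j)).
by move=> z [y Wy <-]; exists y => //; split => //; exact: W_cdom.
Qed.

Lemma ginv_chartCk (k : nat) : chartCk_mx c W k G.
Proof.
exact: (chartCk_mx_inv W_cdom W_image_open gmat_unit (gmat_chartCk k)).
Qed.

Lemma ginv_sym y : W y -> (G y)^T = G y.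
Proof.
by move=> Wy; rewrite /G /ginv trmx_inv gmat_sym//; exact: W_cdom.
Qed.

Lemma mul_ginv_gmat y : W y -> G y *m g c y = 1%:M.
Proof. by move=> Wy; exact: mulVmx (gmat_unit Wy). Qed.

Lemma mul_gmat_ginv y : W y -> g c y *m G y = 1%:M.
Proof. by move=> Wy; exact: mulmxV (gmat_unit Wy). Qed.

Lemma pd_gmat_sym k i j y : W y ->
  pd c k (fun y => g c y i j) y = pd c k (fun y => g c y j i) y.
Proof.
apply: pd_ext => // z Wz.
by rewrite -[in RHS](gmat_sym g c_atlas (W_cdom Wz)) mxE.
Qed.

Lemma christoffel_sym m i j y : W y ->
  christoffel g c m i j y = christoffel g c m j i y.
Proof.
move=> Wy; congr (_ * _); apply: eq_bigr => l _; congr (_ * _).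
by rewrite (pd_gmat_sym l i j Wy); ring.
Qed.

Lemma christoffel_chartCk (k : nat) m i j : chartCk c W k (christoffel g c m i j).
Proof.
have Cp a b d : chartCk c W k (pd c a (fun y => g c y b d)).
  exact: (chartCk_pd W_cdom W_image_open a (gmat_chartCk k.+1 b d)).
apply: chartCkZ => //; apply: chartCk_sum => // l _; apply: chartCkM => //.
  exact: (ginv_chartCk k m l).
by apply: chartCkB => //; apply: chartCkD.
Qed.

Lemma connection_chartCk (k : nat) i : chartCk_mx c W k (N i).
Proof.
move=> a b; apply: (chartCk_ext W_cdom W_image_open _ (christoffel_chartCk k a i b)).
by move=> y _; rewrite mxE.
Qed.

(** Lowering the upper index of the Christoffel symbols gives half of a sum
    whose last two terms are antisymmetric in the free indices. *)
Lemma gmat_connection k y : W y ->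
  pd_mx c k (g c) y = g c y *m N k y + (g c y *m N k y)^T.
Proof.
move=> Wy.
have eN i j : (g c y *m N k y) i j = 2^-1 * (pd c k (fun y => g c y j i) y
    + pd c j (fun y => g c y k i) y - pd c i (fun y => g c y k j) y).
  pose A : 'M[R]_n := \matrix_(l, b) (2^-1 * (pd c k (fun y => g c y b l) y
    + pd c b (fun y => g c y k l) y - pd c l (fun y => g c y k b) y)).
  suff -> : N k y = G y *m A by rewrite mulmxA mul_gmat_ginv// mul1mx mxE.
  apply/matrixP => a b; rewrite !mxE /christoffel mulr_sumr; apply: eq_bigr => l _.
  by rewrite mxE mulrCA.
apply/matrixP => i j; rewrite [LHS]mxE [RHS]mxE [X in _ + X]mxE !eN.
by rewrite (pd_gmat_sym k j i Wy); move: (pd _ _ _ _) => p; field.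
Qed.

(** Metric compatibility for the inverse metric, from [d_k (G g) = 0]. *)
Lemma pd_ginv k y : W y ->
  pd_mx c k G y = - (N k y *m G y + G y *m (N k y)^T).
Proof.
move=> Wy.
have /eqP : pd_mx c k G y *m g c y + G y *m pd_mx c k (g c) y = 0.
  rewrite -(pd_mxM W_cdom W_image_open k (ginv_chartCk 1) (gmat_chartCk 1) Wy).
  rewrite -(pd_mx_cst c k (1%:M : 'M[R]_n) y).
  exact: (pd_mx_ext W_cdom W_image_open k mul_ginv_gmat Wy).
rewrite addr_eq0 => /eqP e.
rewrite -[LHS]mulmx1 -(mul_gmat_ginv Wy) mulmxA e (gmat_connection k Wy).
rewrite trmx_mul (gmat_sym g c_atlas (W_cdom Wy)) mulNmx; congr (- _).
rewrite mulmxDr mulmxDl mulmxA (mul_ginv_gmat Wy) mul1mx; congr (_ + _).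
by rewrite -!mulmxA (mul_gmat_ginv Wy) mulmx1.
Qed.

(** The inverse metric is parallel, so the commutator of covariant derivatives
    annihilates it. *)
Lemma curvature_antisym j i y : W y ->
  (curvature g c j i y *m G y)^T = - (curvature g c j i y *m G y).
Proof.
move=> Wy.
have CG := ginv_chartCk 1; have CN l := connection_chartCk 1 l.
have e a b : pd_mx c a (pd_mx c b G) y =
   - (pd_mx c a (N b) y *m G y - N b y *m (N a y *m G y + G y *m (N a y)^T) +
     (- (N a y *m G y + G y *m (N a y)^T) *m (N b y)^T
      + G y *m (pd_mx c a (N b) y)^T)).
  rewrite (pd_mx_ext W_cdom W_image_open a (pd_ginv b) Wy).
  have C1 := chartCk_mxM W_cdom W_image_open (CN b) CG.
  have C2 := chartCk_mxM W_cdom W_image_open CG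
    (chartCk_mx_tr W_cdom W_image_open (CN b)).
  rewrite (pd_mxN W_cdom W_image_open a (chartCk_mxD W_cdom W_image_open C1 C2) Wy).
  rewrite (pd_mxD W_cdom W_image_open a C1 C2 Wy).
  rewrite (pd_mxM W_cdom W_image_open a (CN b) CG Wy).
  rewrite (pd_mxM W_cdom W_image_open a CG (chartCk_mx_tr W_cdom W_image_open (CN b)) Wy).
  by rewrite pd_mx_tr (pd_ginv a Wy) mulmxN.
have := pd_mx_comm W_cdom W_image_open j i (ginv_chartCk 2) Wy.
rewrite (e j i) (e i j); exact: commutator_antisym (ginv_sym Wy).
Qed.

Lemma ricci_curvature a i y : W y ->
  ricci g c y a i = \sum_j curvature g c j i y j a.
Proof.
move=> Wy; rewrite mxE; apply: eq_bigr => j _; rewrite !mxE.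
have e s t : pd c s (fun y => N t y j a) y = pd c s (christoffel g c j a t) y.
  apply: (pd_ext W_cdom W_image_open s _ Wy) => z Wz.
  by rewrite mxE (christoffel_sym _ _ _ Wz).
rewrite !e -sumrB; congr (_ + _); apply: eq_bigr => l _; rewrite !mxE.
by rewrite (christoffel_sym l i a Wy) (christoffel_sym l a j Wy).
Qed.


(** The components of the covariant derivative of a covector field. *)
Definition covd (k : 'I_n) (a : M -> 'rV[R]_n) y : 'rV[R]_n :=
  pd_mx c k a y - a y *m N k y.

Lemma covdE k a i y : covd k a y 0 i = pd c k (fun y => a y 0 i) y
  - \sum_m a y 0 m * christoffel g c m k i y.
Proof. by rewrite !mxE; under eq_bigr do rewrite mxE. Qed.

Lemma covd_chartCk (m : nat) k a : chartCk_mx c W m.+1 a ->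
  chartCk_mx c W m (covd k a).
Proof.
move=> Ca.
have Ca' := chartCk_mx_le (leqnSn m) Ca.
have C1 := chartCk_mxM W_cdom W_image_open Ca' (connection_chartCk m k).
have C2 := chartCk_mxN W_cdom W_image_open C1.
exact: (chartCk_mxD W_cdom W_image_open
  (chartCk_mx_pd W_cdom W_image_open k Ca) C2).
Qed.

(** The Leibniz rule for the pairing of covector fields: the derivative of the
    inverse metric supplies exactly the two connection terms. *)
Lemma pd_pairing k (a b : M -> 'rV[R]_n) y :
  chartCk_mx c W 1 a -> chartCk_mx c W 1 b -> W y ->
  pd_mx c k (fun y => a y *m G y *m (b y)^T) y =
  covd k a y *m G y *m (b y)^T + a y *m G y *m (covd k b y)^T.
Proof.
move=> Ca Cb Wy.
have CaG := chartCk_mxM W_cdom W_image_open Ca (ginv_chartCk 1).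
rewrite (pd_mxM W_cdom W_image_open k CaG
  (chartCk_mx_tr W_cdom W_image_open Cb) Wy).
rewrite (pd_mxM W_cdom W_image_open k Ca (ginv_chartCk 1) Wy).
rewrite pd_mx_tr (pd_ginv k Wy) /covd.
move: (pd_mx c k a y) (pd_mx c k b y) (a y) (b y) (N k y) (G y) => A B a0 b0 P K.
have -> : (B - b0 *m P)^T = B^T - P^T *m b0^T.
  by rewrite -trmx_mul; apply/matrixP => r s; rewrite !mxE.
rewrite !(mulmxDr, mulmxDl, mulmxN, mulNmx) !mulmxA.
by apply/matrixP => r s; rewrite !mxE; ring.
Qed.

Lemma covd_comm i j (a : M -> 'rV[R]_n) y : chartCk_mx c W 2 a -> W y ->
  covd j (covd i a) y - covd i (covd j a) y = - (a y *m curvature g c j i y).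
Proof.
move=> Ca Wy; have Ca1 := chartCk_mx_le (isT : (1 <= 2)%N) Ca.
have e k l : covd k (covd l a) y =
    pd_mx c k (pd_mx c l a) y
    - (pd_mx c k a y *m N l y + a y *m pd_mx c k (N l) y)
    - (pd_mx c l a y - a y *m N l y) *m N k y.
  rewrite {1}/covd; congr (_ - _).
  have C1 := chartCk_mx_pd W_cdom W_image_open l Ca.
  have CN := connection_chartCk 1 l.
  have C2 := chartCk_mxM W_cdom W_image_open Ca1 CN.
  rewrite (pd_mxD W_cdom W_image_open k C1 (chartCk_mxN W_cdom W_image_open C2) Wy).
  rewrite (pd_mxN W_cdom W_image_open k C2 Wy).
  by rewrite (pd_mxM W_cdom W_image_open k Ca1 CN Wy).
rewrite (e j i) (e i j) (pd_mx_comm W_cdom W_image_open j i Ca Wy).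
rewrite /curvature -/N.
move: (pd_mx c i (pd_mx c j a) y) (pd_mx c j a y) (pd_mx c i a y) => A B C.
move: (pd_mx c j (N i) y) (pd_mx c i (N j) y) (N i y) (N j y) => D E P Q.
rewrite !(mulmxDr, mulmxDl, mulmxN, mulNmx) !mulmxA.
by apply/matrixP => r s; rewrite !mxE; ring.
Qed.

Lemma normg2_mxtrace (T : 'M[R]_n) y : W y ->
  normg2 g c y T = \tr (G y *m T *m G y *m T^T).
Proof.
move=> Wy; rewrite /normg2 /mxtrace; apply: eq_bigr => i _.
rewrite mxE; apply: eq_bigr => j _; rewrite mxE mulr_suml.
rewrite exchange_big/=; apply: eq_bigr => l _.
rewrite !mxE !mulr_suml; apply: eq_bigr => k _.
have -> : G y l j = G y j l by rewrite -[in RHS](ginv_sym Wy) mxE.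
by rewrite /G; ring.
Qed.

Lemma gdotE f h y : W y ->
  gdot g c f h y = (dform c f y *m G y *m (dform c h y)^T) 0 0.
Proof.
move=> Wy; rewrite /gdot /ev2 /grad trmx_mul -/G (ginv_sym Wy).
by rewrite !mulmxA mulmxKV// ?gmat_unit.
Qed.

Section Hessian.
Variable v : M -> R.
Hypothesis Cv : chartCk c W 3 v.
Let w := dform c v.

Lemma dform_chartCk (k : nat) f : chartCk c W k.+1 f ->
  chartCk_mx c W k (dform c f).
Proof.
move=> Cf i j; apply: (chartCk_ext W_cdom W_image_open _
  (chartCk_pd W_cdom W_image_open j Cf)) => y _.
by rewrite mxE.
Qed.

(** The Hessian is the covariant derivative of the differential. *)
Lemma row_hess i y : row i (hess g c v y) = covd i w y.
Proof.
apply/rowP => j; rewrite !mxE; congr (_ - _).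
  by congr (pd c i _ y); apply/funext => z; rewrite mxE.
by apply: eq_bigr => m _; rewrite !mxE mulrC.
Qed.

Lemma hessE i j y : hess g c v y i j = covd i w y 0 j.
Proof. by rewrite -row_hess [RHS]mxE. Qed.

Lemma hess_sym y : W y -> (hess g c v y)^T = hess g c v y.
Proof.
move=> Wy; apply/matrixP => i j; rewrite !mxE.
rewrite (pd_comm W_cdom W_image_open j i (chartCk_pred Cv) Wy).
by congr (_ - _); apply: eq_bigr => m _; rewrite (christoffel_sym m j i Wy).
Qed.

Lemma pd_gdot k y : W y ->
  pd c k (gdot g c v v) y = 2 * (covd k w y *m G y *m (w y)^T) 0 0.
Proof.
move=> Wy; have Cw := dform_chartCk (chartCk_pred Cv).
rewrite (pd_ext W_cdom W_image_open k (@gdotE v v) Wy) -/w.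
have := congr1 (fun A : 'M[R]_1 => A 0 0) (pd_pairing k Cw Cw Wy).
rewrite mxE => ->; rewrite mxE.
have -> : w y *m G y *m (covd k w y)^T = covd k w y *m G y *m (w y)^T.
  by rewrite -[LHS]trmx11 !trmx_mul trmxK (ginv_sym Wy) mulmxA.
by rewrite -mulr2n mulr_natl.
Qed.

(** The entry i is the component of the third covariant derivative of [v]
    obtained by differentiating in the direction i, then k, then j. *)
Definition covd3 j k y : 'rV[R]_n :=
  covd j (covd k w) y - \sum_m christoffel g c m j k y *: covd m w y.

Lemma hess_gdot j k y : W y -> hess g c (gdot g c v v) y j k =
  2 * (covd3 j k y *m G y *m (w y)^T) 0 0
  + 2 * (covd k w y *m G y *m (covd j w y)^T) 0 0.
Proof.
move=> Wy; have Cw := dform_chartCk Cv.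
have Cw1 := chartCk_mx_le (isT : (1 <= 2)%N) Cw.
have Ch := covd_chartCk k Cw.
have C1 := chartCk_mxM W_cdom W_image_open (chartCk_mxM W_cdom W_image_open Ch
  (ginv_chartCk 1)) (chartCk_mx_tr W_cdom W_image_open Cw1).
rewrite mxE (pd_ext W_cdom W_image_open j (@pd_gdot k) Wy).
rewrite (pdZ W_cdom W_image_open j 2 (C1 0 0) Wy).
have := congr1 (fun A : 'M[R]_1 => A 0 0) (pd_pairing j Ch Cw1 Wy).
rewrite mxE => ->; rewrite [X in 2 * X]mxE mulrDr addrAC; congr (_ + _).
have -> : covd3 j k y *m G y *m (w y)^T =
    covd j (covd k w) y *m G y *m (w y)^T
    - \sum_m christoffel g c m j k y *: (covd m w y *m G y *m (w y)^T).
  have lin (A : 'rV[R]_n) (B : 'I_n -> 'rV[R]_n) a (K : 'M[R]_n) (b : 'cV[R]_n) :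
      (A - \sum_m a m *: B m) *m K *m b
      = A *m K *m b - \sum_m a m *: (B m *m K *m b).
    rewrite !mulmxBl !mulmx_suml; congr (_ - _); apply: eq_bigr => m _.
    by rewrite -!scalemxAl.
  exact: lin.
rewrite [X in _ = 2 * X]mxE mulrDr; congr (_ + _).
rewrite [X in 2 * X]mxE mulrN; congr (- _).
rewrite summxE mulr_sumr; apply: eq_bigr => m _.
by rewrite (pd_gdot m Wy) [X in _ = 2 * X]mxE mulrCA.
Qed.

(** The Hessian is symmetric, hence so is each of its covariant
    derivatives. *)
Lemma covd3_sym j k i y : W y -> covd3 j k y 0 i = covd3 j i y 0 k.
Proof.
move=> Wy.
have hs a b z : W z -> covd a w z 0 b = covd b w z 0 a.
  move=> Wz; apply: etrans (esym (hessE a b z)) _.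
  by apply: etrans _ (hessE b a z); rewrite -[in LHS](hess_sym Wz) mxE.
have e a b : covd3 j a y 0 b = pd c j (fun y => covd a w y 0 b) y
    - \sum_m covd a w y 0 m * christoffel g c m j b y
    - \sum_m covd b w y 0 m * christoffel g c m j a y.
  rewrite [LHS]mxE; congr (_ + _); first exact: covdE.
  rewrite mxE summxE; congr (- _); apply: eq_bigr => m _.
  by rewrite mxE mulrC; congr (_ * _); exact: hs.
apply: etrans (e k i) _; apply: etrans _ (esym (e i k)).
have -> : pd c j (fun y => covd k w y 0 i) y = pd c j (fun y => covd i w y 0 k) y.
  by apply: (pd_ext W_cdom W_image_open j _ Wy) => z Wz; exact: hs.
exact: addrAC.
Qed.

Lemma covd3_comm i j y : W y ->
  covd3 j i y - covd3 i j y = - (w y *m curvature g c j i y).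
Proof.
move=> Wy; rewrite -(covd_comm i j (dform_chartCk Cv) Wy) -/w.
rewrite /covd3; have -> : \sum_m christoffel g c m j i y *: covd m w y
        = \sum_m christoffel g c m i j y *: covd m w y.
  by apply: eq_bigr => m _; rewrite (christoffel_sym m j i Wy).
move: (covd j _ y) (covd i _ y) (\sum_m _) => A B S.
by rewrite opprB addrA subrK.
Qed.

(** The trace commutes with covariant differentiation because the inverse
    metric is parallel. *)
Lemma pd_laplacian i y : W y ->
  pd c i (laplacian g c v) y = \sum_j \sum_k G y j k * covd3 i j y 0 k.
Proof.
move=> Wy; pose h := hess g c v.
have Ch : chartCk_mx c W 1 h.
  move=> a b; have Cw := covd_chartCk a (dform_chartCk Cv).
  apply: (chartCk_ext W_cdom W_image_open _ (Cw 0 b)) => z _.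
  exact: esym (hessE a b z).
have ChT := chartCk_mx_tr W_cdom W_image_open Ch.
have CGh := chartCk_mxM W_cdom W_image_open (ginv_chartCk 1) ChT.
rewrite (pd_ext W_cdom W_image_open i (h := fun y => \tr (G y *m (h y)^T)) _ Wy);
  last by move=> z _; exact: trg_mxtrace.
rewrite (pd_mxtrace W_cdom W_image_open i CGh Wy).
rewrite (pd_mxM W_cdom W_image_open i (ginv_chartCk 1) ChT Wy).
rewrite pd_mx_tr (pd_ginv i Wy).
have -> : \tr (- (N i y *m G y + G y *m (N i y)^T) *m (h y)^T
      + G y *m (pd_mx c i h y)^T) =
    \tr (G y *m (pd_mx c i h y - h y *m N i y - (N i y)^T *m h y)^T).
  move: (N i y) (pd_mx c i h y) (G y) (h y) => P A K B.
  have -> : (A - B *m P - P^T *m B)^T = A^T - P^T *m B^T - B^T *m P.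
    rewrite -trmx_mul -[X in _ - _ *m X]trmxK -trmx_mul.
    by apply/matrixP => r s; rewrite !mxE.
  have trN (C : 'M[R]_n) : \tr (- C) = - \tr C by exact: raddfN.
  rewrite mulNmx mulmxDl !mulmxBr !mulmxA !(mxtraceD, trN).
  by rewrite -(mulmxA P) (mxtrace_mulC P); ring.
apply: eq_bigr => j _; rewrite mxE; apply: eq_bigr => k _.
rewrite mxE; congr (_ * _).
rewrite [LHS]mxE [RHS]mxE; congr (_ + _); last first.
  rewrite [LHS]mxE [RHS]mxE summxE; congr (- _).
  rewrite [LHS]mxE; apply: eq_bigr => m _; rewrite [RHS]mxE.
  by congr (_ * _); [rewrite mxE mxE|exact: hessE].
rewrite [LHS]mxE [RHS]covdE [X in X + _]mxE; congr (_ + _).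
  by apply: (pd_ext W_cdom W_image_open i _ Wy) => z _; exact: hessE.
rewrite [LHS]mxE; congr (- _); rewrite [LHS]mxE; apply: eq_bigr => m _.
by congr (_ * _); [exact: hessE|rewrite mxE].
Qed.

(** Ricci contracts the upper index of the curvature with a lower one, whereas
    here two lower indices are contracted with [G]; antisymmetry exchanges the
    two contractions. *)
Lemma ricci_contraction i y : W y ->
  \sum_j \sum_k G y j k * (w y *m curvature g c j i y) 0 k =
  - \sum_a ricci g c y a i * grad g c v y 0 a.
Proof.
move=> Wy.
have -> : \sum_a ricci g c y a i * grad g c v y 0 a =
    \sum_j (w y *m G y *m (curvature g c j i y)^T) 0 j.
  under eq_bigr do rewrite (ricci_curvature _ _ Wy) mulr_suml.
  rewrite exchange_big/=; apply: eq_bigr => j _.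
  rewrite [RHS]mxE; apply: eq_bigr => a _.
  by rewrite mulrC; congr (_ * _); rewrite [RHS]mxE.
rewrite -sumrN; apply: eq_bigr => j _.
rewrite -mulmxA -[in RHS](ginv_sym Wy) -trmx_mul (curvature_antisym j i Wy).
rewrite mulmxN mulmxA [X in - X]mxE opprK [RHS]mxE; apply: eq_bigr => k _.
by rewrite mulrC; congr (_ * _); rewrite -[in RHS](ginv_sym Wy) [RHS]mxE.
Qed.

(** Bochner's formula.  In the trace of [hess_gdot] the third derivative
    [(j, k, i)] is rewritten as [(j, i, k)] by symmetry of the Hessian and as
    [(i, j, k)] plus a curvature term by [covd3_comm]; [pd_laplacian] and
    [ricci_contraction] contract the result. *)
Theorem bochner y : W y ->
  laplacian g c (gdot g c v v) y =
  2 * normg2 g c y (hess g c v y) + 2 * gdot g c v (laplacian g c v) y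
  + 2 * ev2 (ricci g c y) (grad g c v y) (grad g c v y).
Proof.
move=> Wy; set X := grad g c v y.
have pairX (a : 'rV[R]_n) : (a *m G y *m (w y)^T) 0 0 = \sum_i a 0 i * X 0 i.
  rewrite -mulmxA mxE; apply: eq_bigr => i _; congr (_ * _).
  by rewrite -[G y](ginv_sym Wy) -trmx_mul mxE.
have eH : laplacian g c (gdot g c v v) y =
    2 * (\sum_j \sum_k G y j k * (covd k w y *m G y *m (covd j w y)^T) 0 0)
    + 2 * (\sum_i X 0 i * \sum_j \sum_k G y j k * covd3 j k y 0 i).
  rewrite addrC.
  have -> : \sum_i X 0 i * (\sum_j \sum_k G y j k * covd3 j k y 0 i) =
      \sum_j \sum_k G y j k * (covd3 j k y *m G y *m (w y)^T) 0 0.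
    under eq_bigr do rewrite mulr_sumr.
    rewrite exchange_big/=; apply: eq_bigr => j _.
    under eq_bigr do rewrite mulr_sumr.
    rewrite exchange_big/=; apply: eq_bigr => k _.
    rewrite pairX mulr_sumr; apply: eq_bigr => i _.
    by rewrite mulrC -mulrA.
  rewrite -mulrDr -big_split mulr_sumr; apply: eq_bigr => j _ /=.
  rewrite -big_split mulr_sumr; apply: eq_bigr => k _ /=.
  by rewrite (hess_gdot j k Wy) -!mulrDr mulrCA.
rewrite eH -addrA; congr (_ + _).
  congr (_ * _); rewrite (normg2_mxtrace _ Wy) -2!mulmxA.
  apply: eq_bigr => j _; rewrite [RHS]mxE; apply: eq_bigr => k _.
  congr (_ * _); rewrite mulmxA -!row_hess -row_mul [LHS]mxE [RHS]mxE.
  by apply: eq_bigr => l _; congr (_ * _); [rewrite [LHS]mxE|rewrite !mxE].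
rewrite -mulrDr; congr (_ * _).
have -> : gdot g c v (laplacian g c v) y =
    \sum_i X 0 i * pd c i (laplacian g c v) y.
  by rewrite (gdotE _ _ Wy) mxE; apply: eq_bigr => i _; rewrite !mxE.
have -> : ev2 (ricci g c y) X X = \sum_i X 0 i * \sum_a ricci g c y a i * X 0 a.
  rewrite /ev2 mxE; apply: eq_bigr => i _; rewrite mulrC mxE; congr (_ * _).
  by rewrite mxE; apply: eq_bigr => a _; rewrite mulrC.
rewrite -big_split; apply: eq_bigr => i _ /=; rewrite -mulrDr; congr (_ * _).
have := ricci_contraction i Wy => /(congr1 -%R); rewrite opprK => <-.
rewrite (pd_laplacian i Wy) -sumrB; apply: eq_bigr => j _.
rewrite -sumrB; apply: eq_bigr => k _; rewrite -mulrBr; congr (_ * _).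
apply: etrans (covd3_sym j k i Wy) _.
have := congr1 (fun A : 'rV[R]_n => A 0 k) (covd3_comm i j Wy).
rewrite [LHS]mxE [X in _ + X = _]mxE [RHS]mxE => /eqP.
by rewrite subr_eq addrC => /eqP.
Qed.

End Hessian.

End Bochner.

(** * The logarithm of a solution *)

Lemma rank_one_trace (R : comRingType) (n : nat) (A : 'M[R]_n) (w : 'rV[R]_n) :
  \tr (A *m (w^T *m w)) = (w *m A *m w^T) 0 0.
Proof. by rewrite mulmxA mxtrace_mulC mulmxA trace_mx11. Qed.

(** The squared norm of [h + b w (x) w - t g], expanded bilinearly; with [t] the
    trace of the first two terms divided by [n] it is the norm of their
    traceless part. *)
Lemma traceless_norm (R : fieldType) (n : nat) (K G h : 'M[R]_n)
    (w : 'rV[R]_n) (b t : R) :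
  G^T = G -> K^T = K -> h^T = h -> G *m K = 1%:M ->
  let S := h + b *: (w^T *m w) - t *: K in
  \tr (G *m S *m G *m S^T) =
  \tr (G *m h *m G *m h^T) + 2 * b * (w *m G *m h *m (w *m G)^T) 0 0
  + b ^+ 2 * (w *m G *m w^T) 0 0 ^+ 2
  - 2 * t * (\tr (G *m h) + b * (w *m G *m w^T) 0 0) + t ^+ 2 * n%:R.
Proof.
move=> Gs Ks hs GK S; pose P := w^T *m w.
have Ps : P^T = P by rewrite trmx_mul trmxK.
have SE : G *m S = G *m h + b *: (G *m P) - t%:M.
  by rewrite mulmxBr mulmxDr -!scalemxAr GK scalemx1.
have -> : S^T = S.
  rewrite /S -/P -[in RHS]hs -[in RHS]Ps -[in RHS]Ks.
  by apply/matrixP => i j; rewrite !mxE.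
rewrite -mulmxA SE hs -[G *m h *m G *m h]mulmxA.
have tD (X Y : 'M[R]_n) : \tr (X + Y) = \tr X + \tr Y by exact: mxtraceD.
have tN (X : 'M[R]_n) : \tr (- X) = - \tr X by exact: raddfN.
have tZ c (X : 'M[R]_n) : \tr (c *: X) = c * \tr X by exact: mxtraceZ.
have e1 : \tr (G *m P) = (w *m G *m w^T) 0 0 by exact: rank_one_trace.
have e2 : \tr (G *m h *m (G *m P)) = (w *m G *m h *m (w *m G)^T) 0 0.
  by rewrite mulmxA rank_one_trace trmx_mul Gs !mulmxA.
have e3 : \tr (G *m P *m (G *m P)) = (w *m G *m w^T) 0 0 ^+ 2.
  rewrite mulmxA rank_one_trace.
  have -> : w *m (G *m P *m G) *m w^T = (w *m G *m w^T) *m (w *m G *m w^T).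
    by rewrite /P !mulmxA.
  by rewrite [LHS]mxE big_ord1 expr2.
rewrite !(mulmxDl, mulmxDr, mulNmx, mulmxN) -!scalemxAl -!scalemxAr.
rewrite !(mul_scalar_mx, mul_mx_scalar) !(tD, tN, tZ) e3 e2.
rewrite [\tr (G *m P *m (G *m h))]mxtrace_mulC e2 e1 mxtrace_scalar -mulr_natr.
by ring.
Qed.

Section Regular.
Context (R : realType) (n : nat) (M : manifold R n) (g : metric M).
Context (c : chart R n M).
Hypothesis c_atlas : atlas c.

Lemma chart_image_open (U : set M) : open U -> open (cmap c @` (U `&` cdom c)).
Proof.
move=> Uo.
have -> : cmap c @` (U `&` cdom c) = cmap c @` cdom c `&` (cinv c @^-1` U).
  apply/seteqP; split => z /=.
    by move=> [y [Uy cy] <-]; split; [exists y|rewrite cmapK].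
  by move=> [[y cy <-]]; rewrite cmapK// => Uy; exists y.
rewrite openE => z [Oz Uz]; apply: filterI.
  by apply: open_nbhs_nbhs; split => //; exact: cimage_open.
by apply: (cinv_continuous Oz); exact: open_nbhs_nbhs.
Qed.

Lemma dform_ext (W : set M) f h y : W `<=` cdom c -> open (cmap c @` W) ->
  (forall y, W y -> f y = h y) -> W y -> dform c f y = dform c h y.
Proof.
move=> Wc Wo fh Wy; apply/rowP => i; rewrite !mxE.
exact: (pd_ext Wc Wo i fh Wy).
Qed.

Lemma laplacian_ext (W : set M) f h y : W `<=` cdom c -> open (cmap c @` W) ->
  (forall y, W y -> f y = h y) -> W y ->
  laplacian g c f y = laplacian g c h y.
Proof.
move=> Wc Wo fh Wy; congr (trg g c y _); apply/matrixP => i j.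
rewrite [LHS]mxE [RHS]mxE; apply: (congr2 (fun a b : R => a - b)).
  by apply: (pd_ext Wc Wo i _ Wy) => z Wz; exact: (pd_ext Wc Wo j fh Wz).
by apply: eq_bigr => k _; rewrite (pd_ext Wc Wo k fh Wy).
Qed.

Lemma gdot_chartCk (W : set M) (k : nat) f h :
  W `<=` cdom c -> open (cmap c @` W) ->
  chartCk c W k.+1 f -> chartCk c W k.+1 h ->
  chartCk c W k (gdot g c f h).
Proof.
move=> Wc Wo Cf Ch.
have C1 := chartCk_mxM Wc Wo (dform_chartCk Wc Wo Cf) (ginv_chartCk g c_atlas Wc Wo k).
have C2 := chartCk_mxM Wc Wo C1 (chartCk_mx_tr Wc Wo (dform_chartCk Wc Wo Ch)).
by apply: (chartCk_ext Wc Wo _ (C2 0 0)) => y Wy; rewrite (gdotE g c_atlas Wc).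
Qed.

(** Openness is what makes derivatives at a regular point depend only on
    values at regular points; it comes from the continuity of |grad u|^2. *)
Lemma regular_image_open (Om : set M) u : open Om ->
  chartCk c (Om `&` cdom c) 2 u -> open (cmap c @` regular_set g c Om u).
Proof.
move=> Omo Cu; pose V := Om `&` cdom c.
have Vc : V `<=` cdom c by move=> y [].
have Vo : open (cmap c @` V) by exact: chart_image_open.
have Cg : chartCk c V 1 (gdot g c u u) by exact: (gdot_chartCk Vc Vo Cu Cu).
have -> : cmap c @` regular_set g c Om u =
    cmap c @` V `&` [set z | 0 < (gdot g c u u \o cinv c) z].
  apply/seteqP; split => z /=.
    move=> [y [Oy cy gy] <-]; split; first by exists y.
    by rewrite cmapK//; move: gy; rewrite /gradnorm sqrtr_gt0.
  move=> [[y [Oy cy] <-]]; rewrite cmapK// => gy.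
  by exists y => //; split => //; rewrite /gradnorm sqrtr_gt0.
rewrite openE => z [Oz gz]; apply: filterI.
  exact: (open_nbhs_nbhs (conj Vo Oz)).
have Cz : {for z, continuous (gdot g c u u \o cinv c)}.
  exact: (Ck_continuous (k := 1) Cg Oz).
exact: (Cz [set r | 0 < r] (lt_nbhsr gz)).
Qed.


Section RegularPart.
Context (Om : set M) (q p : R) (u : M -> R).
Hypothesis Om_domain : is_domain Om.
Hypothesis u_sol : positive_classical_solution g Om q p u.
Let W := regular_set g c Om u.
Let v y := ln (u y).
Let H := gdot g c v v.
Let L y := gradnorm g c v y `^ q * u y `^ (p + q - 1).

Lemma regular_cdom : W `<=` cdom c.
Proof. by move=> y []. Qed.

Lemma regular_open : open (cmap c @` W).
Proof.
have [C2 _ _] := u_sol.2 c c_atlas.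
by apply: regular_image_open C2; case: Om_domain.
Qed.

Let Wc := regular_cdom.
Let Wo := regular_open.

Lemma u_gt0 y : W y -> 0 < u y.
Proof. by move=> [Oy _ _]; exact: u_sol.1. Qed.

Lemma u_chartCk3 : chartCk c W 3 u.
Proof.
have [_ C3 _] := u_sol.2 c c_atlas.
by apply: Ck_subset C3 => z [y Wy <-]; exists y => //; split => //; exact: Wc.
Qed.

Lemma ln_u_chartCk3 : chartCk c W 3 v.
Proof. by apply: (chartCk_ln Wc Wo u_gt0); exact: u_chartCk3. Qed.

(** Stated without division, so that differentiating it once more gives the
    Hessian of [ln u]. *)
Lemma pd_ln_u i y : W y -> pd c i u y = u y * pd c i v y.
Proof.
move=> Wy; rewrite (pd_ln Wc i u_gt0 (chartCk_le (isT : (1 <= 3)%N) u_chartCk3) Wy).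
by rewrite mulVKf// gt_eqF// u_gt0.
Qed.

Lemma dform_ln_u y : W y -> dform c u y = u y *: dform c v y.
Proof. by move=> Wy; apply/rowP => i; rewrite !mxE pd_ln_u. Qed.

Lemma gdot_ln_u y : W y -> gdot g c u u y = u y ^+ 2 * H y.
Proof.
move=> Wy; rewrite /H !(gdotE g c_atlas Wc _ _ Wy) (dform_ln_u Wy).
rewrite linearZ/= -!scalemxAl -scalemxAr !mxE; ring.
Qed.

Lemma H_gt0 y : W y -> 0 < H y.
Proof.
move=> Wy; have [_ _] := Wy; rewrite /gradnorm sqrtr_gt0 (gdot_ln_u Wy).
by rewrite pmulr_rgt0// exprn_gt0// u_gt0.
Qed.

Lemma gradnorm_ln_u y : W y -> gradnorm g c u y = u y * gradnorm g c v y.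
Proof.
move=> Wy; rewrite /gradnorm (gdot_ln_u Wy) sqrtrM ?sqr_ge0//.
by rewrite sqrtr_sqr ger0_norm// ltW// u_gt0.
Qed.

Lemma hess_ln_u y : W y ->
  (u y)^-1 *: hess g c u y = hess g c v y + (dform c v y)^T *m dform c v y.
Proof.
move=> Wy; have u0 : u y != 0 by rewrite gt_eqF// u_gt0.
have C1 := chartCk_le (isT : (1 <= 3)%N) u_chartCk3.
have e i j : pd c i (pd c j u) y =
    pd c i u y * pd c j v y + u y * pd c i (pd c j v) y.
  rewrite (pd_ext Wc Wo i (@pd_ln_u j) Wy) (pdM Wc i C1 _ Wy)//.
  by apply: (chartCk_pd Wc Wo); exact: (chartCk_pred ln_u_chartCk3).
apply: (scalerI u0); rewrite scalerA divff// scale1r.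
apply/matrixP => i j.
have -> : (u y *: (hess g c v y + (dform c v y)^T *m dform c v y)) i j =
    u y * (pd c i (pd c j v) y - \sum_k christoffel g c k i j y * pd c k v y
           + pd c i v y * pd c j v y).
  rewrite mxE mxE; congr (_ * (_ + _)); first by rewrite mxE.
  by rewrite mxE big_ord1 !mxE.
rewrite mxE e (pd_ln_u i Wy).
have -> : \sum_k christoffel g c k i j y * pd c k u y =
    u y * \sum_k christoffel g c k i j y * pd c k v y.
  by rewrite mulr_sumr; apply: eq_bigr => k _; rewrite (pd_ln_u k Wy) mulrCA.
move: (\sum_k _) (pd c i (pd c j v) y) (pd c i v y) (pd c j v y) => s d a b.
by ring.
Qed.

Lemma tr_outer_ln_u y : W y ->
  \tr (ginv g c y *m ((dform c v y)^T *m dform c v y)) = H y.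
Proof. by move=> Wy; rewrite rank_one_trace /H (gdotE g c_atlas Wc _ _ Wy). Qed.

(** The equation in terms of [ln u]: the trace of [hess_ln_u], with
    [|grad u| = u |grad ln u|] inserted in the nonlinearity. *)
Lemma laplacian_ln_u y : W y -> laplacian g c v y = - L y - H y.
Proof.
move=> Wy; have [_ _ /(_ y)] := u_sol.2 c c_atlas.
have [Oy cy _] := Wy; move=> /(_ Oy cy).
have ug := u_gt0 Wy; have u0 : u y != 0 by rewrite gt_eqF.
have e : laplacian g c u y = u y * (laplacian g c v y + H y).
  have hu : hess g c u y = u y *: ((u y)^-1 *: hess g c u y).
    by rewrite scalerA divff// scale1r.
  rewrite /laplacian !trg_mxtrace hu (hess_ln_u Wy) -(tr_outer_ln_u Wy).
  rewrite linearZ/= -scalemxAr mxtraceZ; congr (_ * _).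
  rewrite -mxtraceD -mulmxDr; congr (\tr (_ *m _)).
  by apply/matrixP => i j; rewrite !mxE; congr (_ + _); apply: eq_bigr => k _;
    rewrite !mxE mulrC.
rewrite e (gradnorm_ln_u Wy) powRM ?sqrtr_ge0 ?ltW//.
have -> : u y `^ q * gradnorm g c v y `^ q * u y `^ p = u y * L y.
  rewrite /L -[X in _ = X * _](powRr1 (ltW ug)) mulrAC -powRD ?u0 ?implybT//.
  rewrite mulrCA -powRD ?u0 ?implybT// mulrC; congr (_ * _ `^ _); ring.
move=> /eqP; rewrite -mulrDr mulf_eq0 (negbTE u0)/= => /eqP; lra.
Qed.

Lemma gdot_ln_u_log h y : chartCk c W 1 h -> (forall y, W y -> 0 < h y) -> W y ->
  gdot g c v h y = h y * gdot g c v (fun y => ln (h y)) y.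
Proof.
move=> Ch h0 Wy; rewrite !(gdotE g c_atlas Wc _ _ Wy).
have -> : dform c h y = h y *: dform c (fun y => ln (h y)) y.
  apply/rowP => i; rewrite [LHS]mxE [RHS]mxE [X in _ * X]mxE.
  by rewrite (pd_ln Wc i h0 Ch Wy) mulVKf// gt_eqF// h0.
by rewrite linearZ/= -scalemxAr mxE.
Qed.

Lemma L_gt0 y : W y -> 0 < L y.
Proof.
move=> Wy; apply: mulr_gt0; apply: powR_gt0; last exact: u_gt0.
by rewrite sqrtr_gt0; exact: H_gt0.
Qed.

Lemma ln_L y : W y -> ln (L y) = q / 2 * ln (H y) + (p + q - 1) * v y.
Proof.
move=> Wy; have Hy := H_gt0 Wy.
rewrite /L lnM ?posrE ?powR_gt0 ?u_gt0 ?sqrtr_gt0// !ln_powR; congr (_ + _).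
by rewrite /gradnorm -(powR12_sqrt (ltW Hy)) ln_powR mulrA.
Qed.

Lemma H_chartCk : chartCk c W 2 H.
Proof. exact: (gdot_chartCk Wc Wo ln_u_chartCk3 ln_u_chartCk3). Qed.

Lemma gdotD f h y : chartCk c W 1 f -> chartCk c W 1 h -> W y ->
  gdot g c v (fun y => f y + h y) y = gdot g c v f y + gdot g c v h y.
Proof.
move=> Cf Ch Wy; rewrite !(gdotE g c_atlas Wc _ _ Wy).
have -> : dform c (fun y => f y + h y) y = dform c f y + dform c h y.
  by apply/rowP => i; rewrite !mxE (pdD i Cf Ch Wy).
by rewrite linearD/= mulmxDr mxE.
Qed.

Lemma gdotZ a f y : chartCk c W 1 f -> W y ->
  gdot g c v (fun y => a * f y) y = a * gdot g c v f y.
Proof.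
move=> Cf Wy; rewrite !(gdotE g c_atlas Wc _ _ Wy).
have -> : dform c (fun y => a * f y) y = a *: dform c f y.
  by apply/rowP => i; rewrite !mxE (pdZ Wc Wo i a Cf Wy).
by rewrite linearZ/= -scalemxAr mxE.
Qed.

Lemma gdot_ext f h y : (forall y, W y -> f y = h y) -> W y ->
  gdot g c v f y = gdot g c v h y.
Proof.
move=> fh Wy; rewrite !(gdotE g c_atlas Wc _ _ Wy).
by rewrite (dform_ext Wc Wo fh Wy).
Qed.

Lemma laplacian_chartCk : chartCk c W 1 (laplacian g c v).
Proof.
apply: chartCk_sum => // i _; apply: chartCk_sum => // j _.
apply: chartCkM => //; first exact: (ginv_chartCk g c_atlas Wc Wo 1 i j).
have Cw := dform_chartCk Wc Wo ln_u_chartCk3.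
have Ch := covd_chartCk g c_atlas Wc Wo i Cw.
by apply: (chartCk_ext Wc Wo _ (Ch 0 j)) => z _; rewrite -hessE.
Qed.

(** [L] is differentiable because it equals [- Delta v - H]; its logarithmic
    derivative then follows from [ln_L]. *)
Lemma gdot_laplacian_ln_u y : W y ->
  let D := gdot g c v (fun y => ln (H y)) y in
  gdot g c v (laplacian g c v) y =
  - (L y * (q / 2 * D + (p + q - 1) * H y)) - H y * D.
Proof.
move=> Wy D.
have CH : chartCk c W 1 H by exact: chartCk_pred H_chartCk.
have Cv1 := chartCk_le (isT : (1 <= 3)%N) ln_u_chartCk3.
have CL : chartCk c W 1 L.
  have CLH := chartCkD Wo (chartCkZ Wo (-1) laplacian_chartCk)
    (chartCkZ Wo (-1) CH).
  apply: (chartCk_ext Wc Wo _ CLH) => z Wz.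
  by rewrite (laplacian_ln_u Wz); ring.
have ClnH := chartCk_ln Wc Wo H_gt0 CH.
rewrite (gdot_ext (h := fun y => (-1) * L y + (-1) * H y) _ Wy); last first.
  by move=> z Wz; rewrite (laplacian_ln_u Wz); ring.
rewrite (gdotD (chartCkZ Wo (-1) CL) (chartCkZ Wo (-1) CH) Wy).
rewrite (gdotZ (-1) CL Wy) (gdotZ (-1) CH Wy).
rewrite (gdot_ln_u_log CL L_gt0 Wy) (gdot_ln_u_log CH H_gt0 Wy).
rewrite (gdot_ext ln_L Wy).
rewrite (gdotD (chartCkZ Wo _ ClnH) (chartCkZ Wo _ Cv1) Wy).
by rewrite (gdotZ _ ClnH Wy) (gdotZ _ Cv1 Wy) -/D -/H; ring.
Qed.

(** [d H = 2 Hess v (grad v, .)], and [d H = H d ln H]. *)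
Lemma hess_grad_grad y : W y ->
  ev2 (hess g c v y) (grad g c v y) (grad g c v y)
  = 2^-1 * (H y * gdot g c v (fun y => ln (H y)) y).
Proof.
move=> Wy.
have CH : chartCk c W 1 H by exact: chartCk_pred H_chartCk.
rewrite -(gdot_ln_u_log CH H_gt0 Wy) (gdotE g c_atlas Wc _ _ Wy) /ev2.
rewrite -/(grad g c v y).
have -> : dform c H y = 2 *: (grad g c v y *m (hess g c v y)^T).
  apply/rowP => i; rewrite [LHS]mxE (pd_gdot g c_atlas Wc Wo ln_u_chartCk3 i Wy).
  rewrite [RHS]mxE; congr (_ * _); rewrite -row_hess.
  rewrite -mulmxA -[ginv g c y](ginv_sym g c_atlas Wc Wy) -trmx_mul.
  rewrite [LHS]mxE [RHS]mxE; apply: eq_bigr => k _; rewrite mulrC.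
  by congr (_ * _); rewrite [LHS]mxE// [RHS]mxE.
rewrite linearZ/= -scalemxAr [X in _ = _ * X]mxE mulKf ?pnatr_eq0//.
by rewrite [in RHS]trmx_mul trmxK mulmxA.
Qed.

End RegularPart.

End Regular.

(** * The formula *)

Theorem lemma3p1 (R : realType) (n : nat) (M : manifold R n) (g : metric M)
    (Om : set M) (q p : R) (u : M -> R)
    (Om_domain : is_domain Om) (q_ge0 : 0 <= q)
    (u_sol : positive_classical_solution g Om q p u)
    (beta : R) (sigma : M -> R)
    (c : chart R n M) (c_atlas : atlas c)
    (x : M) (x_regular : regular_set g c Om u x) :
  let lnu : M -> R := fun y => ln (u y) in
  let H : M -> R := fun y => gradnorm g c lnu y ^+ 2 in
  let lnH : M -> R := fun y => ln (H y) in
  let l : R := p + q - 1 in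
  let L : M -> R := fun y => gradnorm g c lnu y `^ q * u y `^ l in
  let Z : M -> R := fun y => L y / H y in
  let A : R -> R := fun a => 2 / n%:R * (1 + a) ^+ 2 - 2 * a ^+ 2 in
  let B : R -> R -> R := fun a b =>
    4 / n%:R * (1 + a) * (1 + b) - 4 * a * b - 2 * l in
  let T : 'M[R]_n :=
    (u x)^-1 *: hess g c u x
    - (1 + beta + sigma x * Z x) *: ((dform c lnu x)^T *m dform c lnu x) in
  laplacian g c H x =
    A beta * H x ^+ 2 + A (sigma x) * L x ^+ 2 + B beta (sigma x) * H x * L x
    + (2 * (beta - 1) * H x + (2 * sigma x - q) * L x) * gdot g c lnu lnH x
    + 2 * normg2 g c x (T - (trg g c x T / n%:R) *: g c x)
    + 2 * ev2 (ricci g c x) (grad g c lnu x) (grad g c lnu x).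
Proof.
move=> lnu H lnH l L Z A B T.
pose W := regular_set g c Om u.
have Wc := @regular_cdom R n M g c Om u.
have Wo := regular_open c_atlas Om_domain u_sol.
have Wx : W x := x_regular.
have H0 := H_gt0 c_atlas u_sol.
have HE y : W y -> H y = gdot g c lnu lnu y.
  by move=> Wy; rewrite /H /gradnorm sqr_sqrtr// ltW// H0.
have Hx0 : H x != 0 by rewrite HE// gt_eqF// H0.
have lnHE y : W y -> lnH y = ln (gdot g c lnu lnu y).
  by move=> Wy; rewrite /lnH HE.
have C3 := ln_u_chartCk3 c_atlas Om_domain u_sol.
rewrite (laplacian_ext g Wc Wo HE Wx) (bochner g c_atlas Wc Wo C3 Wx).
rewrite (gdot_laplacian_ln_u c_atlas Om_domain u_sol Wx).
rewrite (gdot_ext c_atlas Om_domain u_sol lnHE Wx) -/lnu -(HE x Wx).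
have Hgg := hess_grad_grad c_atlas Om_domain u_sol Wx.
rewrite -/lnu -(HE x Wx) in Hgg.
move: Hgg; set D := gdot g c lnu _ x => Hgg.
set h := hess g c lnu x; set w := dform c lnu x in T *.
set Ric := ev2 (ricci g c x) _ _.
set G := ginv g c x.
have Gs : G^T = G by exact: (ginv_sym g c_atlas Wc Wx).
have hs : h^T = h by exact: (hess_sym g c_atlas Wc Wo C3 Wx).
have GK : G *m g c x = 1%:M by exact: (mul_ginv_gmat g c_atlas Wc Wx).
have Ks : (g c x)^T = g c x by exact: (gmat_sym g c_atlas (Wc x Wx)).
pose b := - (beta + sigma x * Z x).
have TE : T = h + b *: (w^T *m w).
  rewrite /T (hess_ln_u c_atlas Om_domain u_sol Wx) -/lnu -/h -/w -addrA.
  by congr (_ + _); rewrite -scaleN1r -{1}[w^T *m w]scale1r scalerA -scalerDl /b;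
    congr (_ *: _); ring.
have wGw : (w *m G *m w^T) 0 0 = H x.
  by rewrite (HE x Wx) (gdotE g c_atlas Wc _ _ Wx).
have trh : \tr (G *m h) = - L x - H x.
  rewrite -[h]hs -trg_mxtrace (HE x Wx).
  exact: (laplacian_ln_u c_atlas Om_domain u_sol Wx).
have trT : trg g c x T = - L x - H x + b * H x.
  rewrite trg_mxtrace -/G TE.
  have -> : (h + b *: (w^T *m w))^T = h + b *: (w^T *m w).
    have Ps : (w^T *m w)^T = w^T *m w by rewrite trmx_mul trmxK.
    by rewrite -[in RHS]hs -[in RHS]Ps; apply/matrixP => i j; rewrite !mxE.
  by rewrite mulmxDr -scalemxAr mxtraceD mxtraceZ trh rank_one_trace wGw.
have normT t : normg2 g c x (T - t *: g c x) =
    normg2 g c x h + b * (H x * D) + b ^+ 2 * H x ^+ 2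
    - 2 * t * (- L x - H x + b * H x) + t ^+ 2 * n%:R.
  rewrite !(normg2_mxtrace g c_atlas Wc _ Wx) -/G TE.
  rewrite (traceless_norm _ _ _ Gs Ks hs GK) wGw trh.
  have -> : (w *m G *m h *m (w *m G)^T) 0 0 = 2^-1 * (H x * D) by exact: Hgg.
  by field.
(* In dimension 0 there is no regular point, as [H] would be an empty sum. *)
have n0 : n%:R != 0 :> R.
  rewrite pnatr_eq0; apply/eqP => n0; move/negP: Hx0; apply.
  rewrite (HE x Wx) /gdot /ev2 mxE; apply/eqP; apply: big1 => i _.
  by have : (i < 0)%N by apply: (leq_trans (ltn_ord i)); rewrite n0.
have bH : b * H x = - (beta * H x + sigma x * L x).
  by rewrite /b /Z; field.
rewrite normT trT /A /B -/l -/(L x).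
have -> : b * (H x * D) = b * H x * D by rewrite mulrA.
rewrite -exprMn bH.
by field.
Qed.
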